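(* Let $X_1,\dotsc,X_k$ be metric spaces. Let $c\colon X_1\times\dotsb\times X_k\to\mathbb{R}$ be a Lipschitz function. Let $A_i\subset X_i$ for $i=1,\dotsc,k$ and let $f_i\colon A_i\to\mathbb{R}$, $i=1,\dotsc,k$, be such that for all $x_i\in A_i$, $i=1,\dotsc,k$, there is $$\sum_{i=1}^k f_i(x_i)\leq c(x_1,\dotsc,x_k).$$ Then there exist Lipschitz functions $\tilde{f}_i\colon X_i\to\mathbb{R}$, $i=1,\dotsc,k$, such that $$\sum_{i=1}^k \tilde{f}_i(x_i)\leq c(x_1,\dotsc,x_k)\quad\text{for all }x_i\in X_i,\ i=1,\dotsc,k.$$ Moreover, $f_i(x_i)\leq \tilde{f}_i(x_i)$ for all $x_i\in A_i$ and $i=1,\dotsc,k$. Each $\tilde{f}_i$, $i=1,\dotsc,k$, may be taken so that its Lipschitz constant is at most the Lipschitz constant of $c$.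
   Context: This is a version of the $c$-convexification method used in multi-marginal optimal transport, where $c$ plays the role of the cost function.
   Formalization: The sets A_i are assumed all nonempty or all empty; otherwise the claim fails (k=2, A_1 empty, X_2=A_2=R, c=0, f_2(x)=x^2). The product carries any l^p metric, 1≤p≤∞. *)

(* Defs.v *)
From mathcomp Require Import all_boot all_order all_algebra.
From mathcomp Require Import all_classical all_reals all_analysis.
Set Implicit Arguments.
Unset Strict Implicit.
Unset Printing Implicit Defensive.
Import Order.TTheory GRing.Theory Num.Theory.
Local Open Scope classical_set_scope.
Local Open Scope ring_scope.

(* The Lipschitz predicates of MathComp-Analysis are restricted to normed
   modules, so they are restated here for real functions on a set T with an
   explicitly given distance function d. *)
Definition lipschitz_with (R : realType) (T : Type) (d : T -> T -> R) (L : R)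
    (g : T -> R) : Prop :=
  forall x y : T, `|g x - g y| <= L * d x y.

Definition is_lipschitz (R : realType) (T : Type) (d : T -> T -> R)
    (g : T -> R) : Prop :=
  exists2 L : R, 0 <= L & lipschitz_with d L g.

(* The least Lipschitz constant. The bound 0 <= L matters only when T has at
   most one point. For a g that is not Lipschitz the set is empty and inf takes
   a junk value: use it together with is_lipschitz. *)
Definition lipschitz_const (R : realType) (T : Type) (d : T -> T -> R)
    (g : T -> R) : R :=
  inf [set L : R | 0 <= L /\ lipschitz_with d L g].

(* The l^p product metric on X_1 x ... x X_k for 1 <= p <= +oo: p = 1 is the
   sum metric, p = 2 the Euclidean one, p = +oo the maximum metric. The value
   at p = -oo is junk. *)
Definition prod_dist (R : realType) (k : nat) (X : 'I_k -> metricType R)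
    (p : \bar R) (x y : forall i, X i) : R :=
  if p is r%:E then (\sum_(i < k) mdist (x i) (y i) `^ r) `^ r^-1
  else \big[Num.max/0]_(i < k) mdist (x i) (y i).

(* Main.v *)
Require Import Defs.
From mathcomp Require Import all_boot all_order all_algebra.
From mathcomp Require Import all_classical all_reals all_analysis.
Import Order.TTheory GRing.Theory Num.Theory.
Local Open Scope classical_set_scope.
Local Open Scope ring_scope.

(* When every A_j is nonempty, the f_i are replaced one index at a time by
   their c-transforms
     g(x) = inf over a in prod_j A_j of c(a with x at i) - sum_(j != i) f_j(a_j),
   an infimum of L-Lipschitz functions of x which dominates f_i on A_i and
   satisfies the constraint with A_i enlarged to X_i. When the A_j are empty,
   one point of the product with constant f_i plays their role. *)

Lemma lipschitz_const_le (R : realType) (T : Type) (d : T -> T -> R) (L : R)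
    (g : T -> R) :
  0 <= L -> lipschitz_with d L g -> lipschitz_const d g <= L.
Proof. by move=> L_ge0 gL; apply: ge_inf => //; exists 0 => M []. Qed.

Lemma lipschitz_const_ge0 (R : realType) (T : Type) (d : T -> T -> R)
    (g : T -> R) : is_lipschitz d g -> 0 <= lipschitz_const d g.
Proof. by move=> [L L_ge0 gL]; apply: lb_le_inf => [|M []//]; exists L. Qed.

(** At positive distance every admissible constant bounds the difference quotient, hence so does
    their infimum; at distance zero any single constant forces equal values. *)
Lemma lipschitz_constP (R : realType) (T : Type) (d : T -> T -> R)
    (g : T -> R) : (forall x y, 0 <= d x y) ->
  is_lipschitz d g -> lipschitz_with d (lipschitz_const d g) g.
Proof.
move=> d_ge0 [L L_ge0 gL] x y.
have := d_ge0 x y; rewrite le_eqVlt => /predU1P[d0|d_gt0].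
  by have := gL x y; rewrite -d0 !mulr0.
rewrite -ler_pdivrMr//; apply: lb_le_inf => [|M [_ gM]]; first by exists L.
by rewrite ler_pdivrMr.
Qed.

Lemma prod_dist_ge0 (R : realType) (k : nat) (X : 'I_k -> metricType R)
    (p : \bar R) (x y : forall i, X i) : 0 <= prod_dist p x y.
Proof. by case: p => [r| |] /=; rewrite ?powR_ge0 ?bigmax_ge_id. Qed.

(** Only coordinate [j] contributes. This makes a function Lipschitz for the product metric
    Lipschitz in each variable with the same constant, whatever [p] is. *)
Lemma prod_dist_dfwith (R : realType) (k : nat) (X : 'I_k -> metricType R)
    (p : \bar R) (a : forall i, X i) (j : 'I_k) (x y : X j) :
  (1%:E <= p)%E -> prod_dist p (dfwith a j x) (dfwith a j y) = mdist x y.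
Proof.
have dist0 i : i != j -> mdist (dfwith a j x i) (dfwith a j y i) = 0.
  by move=> ij; rewrite !dfwithout 1?eq_sym// mdistxx.
case: p => [r| |]//=; rewrite ?lee_fin => r_ge1.
  have r_neq0 : r != 0 by rewrite gt_eqF// (lt_le_trans ltr01).
  rewrite (bigD1 j)//= big1 => [|i ij]; last by rewrite dist0// powR0.
  by rewrite addr0 !dfwithin -powRrM divff// powRr1// mdist_ge0.
apply/eqP; rewrite eq_le; apply/andP; split.
  apply/bigmax_leP; split=> [|i _]; first exact: mdist_ge0.
  have [->|ij] := eqVneq i j; first by rewrite !dfwithin.
  by rewrite dist0// mdist_ge0.
by apply: le_trans (le_bigmax _ _ j); rewrite !dfwithin.
Qed.

Section c_transform.
Context (R : realType) (k : nat) (X : 'I_k -> metricType R).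
Variables (c : (forall i, X i) -> R) (L : R).
Hypothesis c_coord_lip : forall (a : forall i, X i) j (x y : X j),
  c (dfwith a j x) <= c (dfwith a j y) + L * mdist x y.

Lemma c_transform (A : forall i, set (X i)) (f : forall i, X i -> R)
    (a0 : forall i, X i) (j : 'I_k) :
  (forall i, A i (a0 i)) ->
  (forall a, (forall i, A i (a i)) -> \sum_i f i (a i) <= c a) ->
  exists g : X j -> R, [/\ lipschitz_with (@mdist R (X j)) L g,
    forall x, A j x -> f j x <= g x
  & forall a, (forall i, i != j -> A i (a i)) ->
      \sum_i dfwith f j g i (a i) <= c a].
Proof.
move=> Aa0 f_le_c.
(* Coordinate [j] of [a] is overwritten in [c] and omitted from the sum, so whole tuples can stand
   for tuples indexed by [i != j]. *)
pose phi (a : forall i, X i) x :=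
  c (dfwith a j x) - \sum_(i | i != j) f i (a i).
pose S x := [set phi a x | a in [set a | forall i, A i (a i)]].
have S0 x : S x !=set0 by exists (phi a0 x), a0.
have f_le_phi a x : (forall i, i != j -> A i (a i)) -> A j x -> f j x <= phi a x.
  move=> Aa Ax; rewrite lerBrDr.
  have := f_le_c (dfwith a j x); rewrite (bigD1 j)//= dfwithin.
  under eq_bigr => i ij do rewrite dfwithout 1?eq_sym//.
  apply=> i; have [->|ij] := eqVneq i j; first by rewrite dfwithin.
  by rewrite dfwithout 1?eq_sym//; exact: Aa.
have phi_lip a x y : phi a x <= phi a y + L * mdist x y.
  by rewrite addrAC lerD2r.
(* As [x] may lie outside [A j], the bound is taken at [a0 j], where [f j] lies below every [phi a],
   and carried to [x] by the Lipschitz estimate. *)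
have S_lb x : has_lbound (S x).
  exists (f j (a0 j) - L * mdist (a0 j) x) => _ [a Aa <-].
  by rewrite lerBlDr (le_trans _ (phi_lip _ _ _))// f_le_phi.
exists (fun x => inf (S x)); split=> [x y|x Ax|a Aa].
- have inf_lip u v : inf (S u) <= inf (S v) + L * mdist u v.
    rewrite -lerBlDr; apply: lb_le_inf => // _ [a Aa <-].
    by rewrite lerBlDr (le_trans _ (phi_lip _ _ _))// ge_inf//; exists a.
  by rewrite ler_distl inf_lip andbT lerBlDr metric_sym inf_lip.
- by apply: lb_le_inf => // _ [a Aa <-]; exact: f_le_phi.
- rewrite (bigD1 j)//= dfwithin.
  under eq_bigr => i ij do rewrite dfwithout 1?eq_sym//.
  (* The point [a j] is arbitrary, so [a] itself need not index the infimum; putting [a0 j] there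
     repairs this without changing [phi]. *)
  have in_A i : A i (dfwith a j (a0 j) i).
    have [->|ij] := eqVneq i j; first by rewrite dfwithin.
    by rewrite dfwithout 1?eq_sym//; exact: Aa.
  rewrite -lerBrDr; suff <- : phi (dfwith a j (a0 j)) (a j) =
      c a - \sum_(i | i != j) f i (a i).
    by apply: ge_inf => //; exists (dfwith a j (a0 j)).
  congr (c _ - _); last by apply: eq_bigr => i ij; rewrite dfwithout 1?eq_sym.
  apply: functional_extensionality_dep => i.
  have [->|ij] := eqVneq i j; first by rewrite dfwithin.
  by rewrite !dfwithout 1?eq_sym.
Qed.

(** Induction on [s], the list of coordinates already freed. The sets [i \notin s -> A i x] are the
    whole space for [i] in [s] and [A i] otherwise, so each step is one transform. *)
Lemma c_transform_iter (A : forall i, set (X i)) (f : forall i, X i -> R)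
    (a0 : forall i, X i) (s : seq 'I_k) :
  (forall i, A i (a0 i)) ->
  (forall a, (forall i, A i (a i)) -> \sum_i f i (a i) <= c a) ->
  exists g : forall i, X i -> R,
    [/\ forall i, i \in s -> lipschitz_with (@mdist R (X i)) L (g i),
        forall i x, A i x -> f i x <= g i x
      & forall a, (forall i, i \notin s -> A i (a i)) ->
          \sum_i g i (a i) <= c a].
Proof.
move=> Aa0 f_le_c; elim: s => [|j s [g [g_lip f_le_g g_le_c]]].
  by exists f; split=> // a Aa; apply: f_le_c => i; exact: Aa.
have [|h [h_lip g_le_h h_le_c]] :=
  @c_transform (fun i => [set x | i \notin s -> A i x]) g a0 j _ g_le_c.
  by move=> i /= _; exact: Aa0.
exists (dfwith g j h); split=> [i|i x Ax|a Aa].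
- have [->|ij] := eqVneq i j; first by rewrite dfwithin.
  by rewrite inE (negPf ij) dfwithout 1?eq_sym//; exact: g_lip.
- have [ij|ij] := eqVneq i j; last by rewrite dfwithout 1?eq_sym// f_le_g.
  subst i; rewrite dfwithin; apply: le_trans (f_le_g _ _ Ax) _.
  exact: g_le_h.
- by apply: h_le_c => i ij /= is_; apply: Aa; rewrite inE negb_or ij.
Qed.

End c_transform.

(** [A_nonempty_all] excludes a mixture of empty and nonempty [A i]: there [f_le_c] is vacuous, and
    an [f j] unbounded above on a bounded [A j] has no Lipschitz majorant. *)
Theorem lemma10p1 (R : realType) (k : nat) (X : 'I_k -> metricType R)
    (p : \bar R) (p_ge1 : (1%:E <= p)%E)
    (c : (forall i, X i) -> R)
    (c_lip : is_lipschitz (prod_dist (X := X) p) c)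
    (A : forall i, set (X i))
    (A_nonempty_all : forall i j, A i !=set0 -> A j !=set0)
    (f : forall i, A i -> R)
    (f_le_c : forall a : (forall i, A i),
       \sum_(i < k) f i (a i) <= c (fun i => \val (a i))) :
  exists ft : forall i, X i -> R,
    [/\ forall i, is_lipschitz (@mdist R (X i)) (ft i),
        forall x : (forall i, X i), \sum_(i < k) ft i (x i) <= c x,
        forall i (a : A i), f i a <= ft i (\val a)
      & forall i, lipschitz_const (@mdist R (X i)) (ft i)
                  <= lipschitz_const (prod_dist (X := X) p) c].
Proof.
set L := lipschitz_const _ c.
have L_ge0 : 0 <= L by exact: lipschitz_const_ge0.
have c_coord_lip (a : forall i, X i) j (x y : X j) :
    c (dfwith a j x) <= c (dfwith a j y) + L * mdist x y.
  rewrite -lerBlDl -(prod_dist_dfwith _ _ _ _ a _ x y p_ge1).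
  apply: le_trans (ler_norm _) _.
  exact: (lipschitz_constP _ _ _ _ (prod_dist_ge0 _ _ _ p) c_lip).
suff [ft [ft_lip ft_le_c f_le_ft]] : exists ft : forall i, X i -> R,
    [/\ forall i, lipschitz_with (@mdist R (X i)) L (ft i),
        forall x : (forall i, X i), \sum_(i < k) ft i (x i) <= c x
      & forall i (a : A i), f i a <= ft i (\val a)].
  by exists ft; split=> // i; [exists L | exact: lipschitz_const_le].
have extend (B : forall i, set (X i)) (f' : forall i, X i -> R)
    (b : forall i, X i) : (forall i, B i (b i)) ->
    (forall a, (forall i, B i (a i)) -> \sum_i f' i (a i) <= c a) ->
    exists ft : forall i, X i -> R,
    [/\ forall i, lipschitz_with (@mdist R (X i)) L (ft i),
        forall x : (forall i, X i), \sum_(i < k) ft i (x i) <= c x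
      & forall i x, B i x -> f' i x <= ft i x].
  move=> Bb f'_le_c.
  have [g [g_lip f'_le_g g_le_c]] :=
    c_transform_iter _ _ _ _ _ c_coord_lip _ _ _ (enum 'I_k) Bb f'_le_c.
  exists g; split=> // [i|x]; first by apply: g_lip; rewrite mem_enum.
  by apply: g_le_c => i; rewrite mem_enum.
have [A_nonempty|/existsNP[i0 Ai0]] := pselect (forall i, A i !=set0).
  pose a0 i := sval (cid (A_nonempty i)).
  have Aa0 i : A i (a0 i) by rewrite /a0; case: cid.
  (* The value 0 off [A i] is harmless: [extend] evaluates [f'] only at points of [A i]. *)
  pose f' i x := if insub x is Some a then f i a else 0.
  have f'E i (a : A i) : f' i (\val a) = f i a by rewrite /f' valK.
  have [|ft [ft_lip ft_le_c f'_le_ft]] := extend A f' a0 Aa0.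
    move=> a Aa; have := f_le_c (fun i => SigSub (mem_set (Aa i))).
    by under eq_bigr do rewrite -f'E /=.
  exists ft; split=> // i a; rewrite -f'E; apply: f'_le_ft.
  exact: set_mem (valP a).
(* From here all [A i] are empty, so domination is vacuous and only the bound by [c] remains to be
   arranged. *)
have A0 i : ~ (A i !=set0) by move=> /(A_nonempty_all i i0).
have no_A i (a : A i) : False.
  by apply: (A0 i); exists (\val a); exact: set_mem (valP a).
have [[x]|noX] := pselect (inhabited (forall i, X i)); last first.
  exists (fun _ _ => 0); split=> [i x y|x|i a].
  - by rewrite subrr normr0 mulr_ge0// mdist_ge0.
  - by case: noX; constructor.
  - by have := no_A _ a.
(* The [k] constants [c x / k%:R] add up to [c x], so the constraint holds with equality at the
   single tuple [x]; [i0] witnesses that [k] is nonzero. *)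
have [||ft [ft_lip ft_le_c _]] :=
    extend (fun i => [set x i]) (fun _ _ => c x / k%:R) x.
- by [].
- move=> a ax; have -> : a = x.
    by apply: functional_extensionality_dep => i; exact: ax.
  have k_neq0 : k%:R != 0 :> R.
    by rewrite pnatr_eq0 -lt0n; case: i0 {Ai0} => m /(leq_trans _); apply.
  by rewrite sumr_const card_ord -[leLHS]mulr_natr divfK.
- by exists ft; split=> // i a; have := no_A _ a.
Qed.
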